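(* Let $\varphi\in(\tfrac34,1)$ be badly approximable and let $1<\alpha\le\tfrac32$. If $X$ is a Sturmian word generated by $\varphi$, then $X$ is a ground-state configuration of $H_\alpha$ that is stable with respect to $\mathcal{PS}_\varphi$; that is, for every finite set $P$ of patterns there exists $\lambda>0$ such that for every $(\lambda,P)$-perturbation $\widetilde H$ of $H_\alpha$ we have $\rho_{\widetilde H}(X)\le\rho_{\widetilde H}(W)$ for all $W\in\mathcal{PS}_\varphi$.
   Context: Circle $=\mathbb{R}/\mathbb{Z}$. For irrational $\varphi$, $X\in\{0,1\}^{\mathbb{Z}}$ is a Sturmian word generated by $\varphi$ if there are $x\in\mathbb{R}/\mathbb{Z}$ and $P_0\in\{[0,\varphi),(0,\varphi]\}$ with $X(n)=0$ if $x+n\varphi\in P_0$ and $X(n)=1$ otherwise. A real $\varphi$ is badly approximable if there is $c>0$ with $|\varphi-p/q|>c/q^2$ for all rationals $p/q$. Forbidden distances: $F=\{k\in\mathbb{N}: k\varphi \bmod 1\in[1-\varphi,\varphi]\}$. Fix $m\in\mathbb{N}$ such that the sequences in $\{0,1\}^{\mathbb{Z}}$ containing no $m$ consecutive $0$'s and no two $1$'s at a distance in $F$ are exactly the Sturmian words generated by $\varphi$ (such $m$ exists). A pattern is a configuration in $\{0,1\}^A$ on a finite set $A\subset\mathbb{Z}$, considered up to translation. A (translation-invariant) Hamiltonian is given by an energy function $\Phi$ on patterns; for a finite word $w$ (or a finite segment of a sequence), $H(w)$ is the sum of $\Phi(p)$ over all occurrences of patterns $p$ inside $w$. $H_\alpha$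 is the Hamiltonian assigning energy $1/n^\alpha$ to the pattern consisting of two $1$'s at distance $n$ for each $n\in F$, energy $1$ to the pattern of $m$ consecutive $0$'s, and energy $0$ to all other patterns. Energy density: $\rho_H(X)=\liminf_{k\to\infty}\frac{H(X([-k,k]))}{2k+1}$, where $X([-k,k])=(X(i))_{i=-k}^k$. For a finite set of patterns $P$ and $\lambda>0$, $\widetilde H$ (with energies $\widetilde\Phi$) is a $(\lambda,P)$-perturbation of $H$ (energies $\Phi$) if $|\Phi(p)-\widetilde\Phi(p)|<\lambda$ for $p\in P$ and $\Phi(q)=\widetilde\Phi(q)$ for $q\notin P$. $\mathcal{PS}_\varphi$ is the set of periodic sequences $Y\in\{0,1\}^{\mathbb{Z}}$ whose period word (one block of length equal to a period) is a subword of some Sturmian word generated by $\varphi$. *)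

(* Defs.v *)
From HB Require Import structures.
From mathcomp Require Import all_boot all_order all_algebra.
From mathcomp Require Import all_classical all_reals all_analysis.
Set Implicit Arguments. Unset Strict Implicit. Unset Printing Implicit Defensive.
Import Order.TTheory GRing.Theory Num.Theory.
Local Open Scope ring_scope.

(* Configurations X : Z -> {0,1}; we encode 0 as false and 1 as true. *)
Definition config := int -> bool.

Definition frac {R : realType} (x : R) : R := x - (Num.floor x)%:~R.

Definition in_P0 {R : realType} (phi : R) (closed_right : bool) (t : R) : bool :=
  if closed_right then (0 < t) && (t <= phi) else (0 <= t) && (t < phi).

Definition sturmian {R : realType} (phi : R) (X : config) : Prop :=
  exists (x : R) (closed_right : bool),
    forall n : int, X n = ~~ in_P0 phi closed_right (frac (x + n%:~R * phi)).

Definition badly_approximable {R : realType} (phi : R) : Prop :=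
  exists c : R, 0 < c /\
    forall (p : int) (q : nat), (0 < q)%N ->
      c / (q%:R ^+ 2) < `|phi - p%:~R / q%:R|.

Definition forbidden {R : realType} (phi : R) (k : nat) : bool :=
  (1 - phi <= frac (k%:R * phi)) && (frac (k%:R * phi) <= phi).

Definition no_m_zeros (m : nat) (X : config) : Prop :=
  ~ exists n : int, forall i : nat, (i < m)%N -> X (n + i%:Z) = false.

Definition no_forbidden_ones {R : realType} (phi : R) (X : config) : Prop :=
  forall (n : int) (k : nat), X n = true -> X (n + k%:Z) = true -> ~~ forbidden phi k.

Definition good_m {R : realType} (phi : R) (m : nat) : Prop :=
  forall X : config, (no_m_zeros m X /\ no_forbidden_ones phi X) <-> sturmian phi X.

(* Patterns up to translation, in canonical form: a list of cells, cell i
   being Some b if position i (relative to the minimum of the support) lies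
   in the support with value b, None otherwise.  Canonical means: nonempty,
   first and last cells are in the support. *)
Definition pattern := seq (option bool).

Definition is_pattern (p : pattern) : bool :=
  [&& p != [::], isSome (head None p) & isSome (last None p)].

Definition strip_left (s : pattern) : pattern := drop (find isSome s) s.
Definition trim (s : pattern) : pattern := rev (strip_left (rev (strip_left s))).

Definition pat_of (w : seq bool) (m : seq bool) : pattern :=
  trim [seq (if bx.1 then Some bx.2 else None) | bx <- zip m w].

Definition energy (R : realType) := pattern -> R.

(* H(w): sum of Phi over all occurrences of (nonempty) patterns inside w,
   i.e. over all nonempty subsets of the positions of w. *)
Definition Hw {R : realType} (Phi : energy R) (w : seq bool) : R :=
  \sum_(m : (size w).-tuple bool | has id m) Phi (pat_of w m).

Definition window (X : config) (k : nat) : seq bool :=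
  [seq X (i%:Z - k%:Z) | i <- iota 0 (2 * k + 1)].

Definition density {R : realType} (Phi : energy R) (X : config) : \bar R :=
  limn_einf (fun k : nat => (Hw Phi (window X k) / (2 * k + 1)%:R)%:E).

Definition two_ones (n : nat) : pattern := Some true :: rcons (nseq n.-1 None) (Some true).
Definition m_zeros (m : nat) : pattern := nseq m (Some false).

Definition H_alpha {R : realType} (phi alpha : R) (m : nat) : energy R :=
  fun p =>
    if [exists n : 'I_(size p), (0 < val n)%N && (p == two_ones n) && forbidden phi n]
    then (powR (size p).-1%:R alpha)^-1
    else if p == m_zeros m then 1 else 0.

Definition perturbation {R : realType} (Phi Phi' : energy R) (lam : R) (P : seq pattern)
  : Prop :=
  (forall p, p \in P -> `|Phi p - Phi' p| < lam) /\
  (forall q, is_pattern q -> q \notin P -> Phi q = Phi' q).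

Definition PS {R : realType} (phi : R) (Y : config) : Prop :=
  exists p : nat, (0 < p)%N /\ (forall n : int, Y (n + p%:Z) = Y n) /\
    exists (t : int) (S : config) (j : int), sturmian phi S /\
      forall i : nat, (i < p)%N -> Y (t + i%:Z) = S (j + i%:Z).

(* Main.v *)
(* Write F for the set of forbidden distances and let W be q-periodic with period
   block taken from a Sturmian word.  Two facts are compared.

   Frequencies: the indicators of the arcs from 0 to j phi span an algebra (the arcs
   are nested) and their orbit sums telescope up to O(1).  Hence every pattern
   occurs in any two Sturmian factors of equal length the same number of times up to
   a constant, and a perturbation of size lam changes the energy of W relative to
   that of X by at most O(lam) per period.

   Energy: as phi is badly approximable, some multiple t q with t = O(q) moves the
   circle by at least 1/4, so for every residue r at least a third of the distances
   r + k q with k < 3 t lie in F.  The ones of W therefore form at least t (q / 2 m)^2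
   forbidden pairs per period at distances at most 3 t q = O(q^2), and their energy is
   at least a constant multiple of t q^2 (t q)^(-3/2), which is bounded below because
   t = O(q). *)
From HB Require Import structures.
From mathcomp Require Import all_boot all_order all_algebra.
From mathcomp Require Import zify ring lra.
From mathcomp Require Import all_classical all_reals all_analysis.
Require Import Defs.
Set Implicit Arguments. Unset Strict Implicit. Unset Printing Implicit Defensive.
Import Order.TTheory GRing.Theory Num.Theory.
Local Open Scope ring_scope.

(** * Occurrences of patterns *)

Lemma strip_leftK (z : pattern) : nseq (find isSome z) None ++ strip_left z = z.
Proof.
rewrite /strip_left; elim: z => [|[b|] z IH] //=.
by rewrite IH.
Qed.

Lemma head_strip_left (z : pattern) : has isSome z -> isSome (head None (strip_left z)).
Proof. by rewrite /strip_left; elim: z => [|[b|] z IH] //=. Qed.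

Lemma strip_left_pad (a : nat) (p : pattern) :
  isSome (head None p) -> strip_left (nseq a None ++ p) = p.
Proof.
move=> hp; rewrite /strip_left; elim: a => [|a IH] //=.
by case: p hp => [|[b|] p].
Qed.

Lemma last_rev (T : Type) (x : T) (s : seq T) : last x (rev s) = head x s.
Proof. by case: s => [|y s] //; rewrite rev_cons last_rcons. Qed.

Lemma head_rev (T : Type) (x : T) (s : seq T) : head x (rev s) = last x s.
Proof. by rewrite -[in RHS](revK s) last_rev. Qed.

Lemma trim_pad (a b : nat) (p : pattern) :
  is_pattern p -> trim (nseq a None ++ p ++ nseq b None) = p.
Proof.
case/and3P=> p0 hp lp; rewrite /trim strip_left_pad; last by case: p p0 hp lp.
by rewrite rev_cat rev_nseq strip_left_pad ?revK // head_rev.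
Qed.

(** Only empty cells are stripped, so padding recovers [z]; together with [trim_pad] this lets a
    mask be read off from its pattern and its offset. *)
Lemma trim_decomp (z : pattern) : has isSome z ->
  is_pattern (trim z) /\ exists a b, z = nseq a None ++ trim z ++ nseq b None.
Proof.
move=> hz; set y := strip_left z.
have hy : isSome (head None y) by exact: head_strip_left.
have hry : has isSome (rev y).
  by rewrite has_rev; case: (y) hy => [|[b|] t].
have ey : y = trim z ++ nseq (find isSome (rev y)) None.
  apply: (can_inj revK); rewrite rev_cat rev_nseq /trim revK.
  by rewrite strip_leftK.
have lt : isSome (last None (trim z)).
  by rewrite /trim last_rev head_strip_left.
split; last first.
  by exists (find isSome z), (find isSome (rev y)); rewrite -ey strip_leftK.
have t0 : trim z != [::] by case: (trim z) lt.
rewrite /is_pattern t0 lt andbT /=.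
by move: hy; rewrite ey; case: (trim z) t0.
Qed.

Definition segment (X : config) (a : int) (n : nat) : seq bool :=
  [seq X (a + i%:Z) | i <- iota 0 n].

Lemma windowE (X : config) (k : nat) : window X k = segment X (- k%:Z) (2 * k + 1).
Proof. by apply: eq_map => i /=; rewrite addrC. Qed.

Lemma size_segment X a n : size (segment X a n) = n.
Proof. by rewrite size_map size_iota. Qed.

(** No window is involved, so for a Sturmian word this is a function of the orbit point. *)
Definition matches (p : pattern) (X : config) (n : int) : bool :=
  all (fun i => if nth None p i is Some b then X (n + i%:Z) == b else true)
      (iota 0 (size p)).

Lemma matchesP p X n :
  reflect (forall i b, (i < size p)%N -> nth None p i = Some b -> X (n + i%:Z) = b)
          (matches p X n).
Proof.
apply: (iffP allP) => h i.
  by move=> b ip eb; have := h i; rewrite mem_iota add0n eb => /(_ ip) /eqP.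
rewrite mem_iota add0n => ip; case e: nth => [b|] //.
by apply/eqP; apply: h.
Qed.

Lemma patternP (p : pattern) : is_pattern p -> exists b t, p = Some b :: t.
Proof. by case: p => [|[b|] t] // _; exists b, t. Qed.

Definition cells (w m : seq bool) : pattern :=
  [seq (if bx.1 then Some bx.2 else None) | bx <- zip m w].

Lemma nth_cells (w m : seq bool) i : size m = size w -> (i < size w)%N ->
  nth None (cells w m) i = if nth false m i then Some (nth false w i) else None.
Proof.
move=> s iw; rewrite /cells (nth_map (false, false)) ?size_zip ?s ?minnn //.
by rewrite nth_zip.
Qed.

Lemma size_cells (w m : seq bool) : size m = size w -> size (cells w m) = size w.
Proof. by move=> s; rewrite size_map size_zip s minnn. Qed.

Lemma isSome_cells (w m : seq bool) : size m = size w -> map isSome (cells w m) = m.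
Proof.
move=> s; apply: (@eq_from_nth _ false); rewrite size_map size_cells // => i iw.
by rewrite (nth_map None) ?size_cells // nth_cells //; case: ifP.
Qed.

Definition support_at (p : pattern) (n s : nat) : seq bool :=
  nseq s false ++ map isSome p ++ nseq (n - (s + size p)) false.

Lemma find_support_at p (s : nat) r : is_pattern p ->
  find id (nseq s false ++ map isSome p ++ r) = s.
Proof. by case/patternP=> b [t ->]; elim: s => [|s IH] //=; rewrite IH. Qed.

Lemma has_support_at p (s : nat) r : is_pattern p ->
  has id (nseq s false ++ map isSome p ++ r).
Proof. by case/patternP=> b [t ->]; rewrite !has_cat /= orbT. Qed.

(** A set of positions is determined by its least element and its trimmed pattern, so the nonempty
    masks giving [p] correspond to the offsets at which [p] matches inside the segment. *)
Lemma mask_patternE (X : config) (a : int) (n s : nat) (m : seq bool) (p : pattern) :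
  is_pattern p -> size m = n ->
  (find id m == s) && (has id m && (pat_of (segment X a n) m == p)) =
  (m == support_at p n s) && ((s + size p <= n)%N && matches p X (a + s%:Z)).
Proof.
move=> pp sm; set w := segment X a n.
have smw : size m = size w by rewrite size_segment.
have nw i : (i < n)%N -> nth false w i = X (a + i%:Z).
  by move=> i_n; rewrite (nth_map 0%N) ?size_iota // nth_iota.
rewrite /pat_of -/(cells w m); apply/idP/idP.
  case/and3P=> /eqP fs hm /eqP tp.
  have hz : has isSome (cells w m).
    by rewrite -[isSome]/(id \o isSome) -has_map isSome_cells.
  have [_ [a' [b' ez]]] := trim_decomp hz; rewrite tp in ez.
  have em : m = nseq a' false ++ map isSome p ++ nseq b' false.
    by rewrite -(isSome_cells smw) ez !map_cat !map_nseq.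
  have ea : a' = s by rewrite -fs em find_support_at.
  subst a'.
  have sn : (s + size p + b' = n)%N.
    by rewrite -sm em !size_cat !size_nseq size_map addnA.
  have -> : m == support_at p n s.
    by rewrite em /support_at -sn addKn.
  rewrite -sn leq_addr /=; apply/matchesP => i b ip eb.
  have isn : (s + i < n)%N by lia.
  have := nth_cells smw (_ : (s + i < size w)%N); rewrite size_segment.
  move=> /(_ isn); rewrite ez nth_cat size_nseq ltnNge leq_addr /= addKn.
  rewrite nth_cat ip eb nw //; case: ifP => // _ [->].
  by rewrite PoszD addrA.
case/and3P=> /eqP em sn /matchesP mt.
have ez : cells w m = nseq s None ++ p ++ nseq (n - (s + size p)) None.
  apply: (@eq_from_nth _ None).
    rewrite size_cells // size_segment !size_cat !size_nseq; lia.
  rewrite size_cells // => i iw; rewrite nth_cells //.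
  rewrite size_segment in iw; rewrite nw // em /support_at !nth_cat !size_nseq.
  rewrite size_map; case: ltnP => [si|si].
    by rewrite !nth_nseq si.
  case: ltnP => ip; last by rewrite !nth_nseq !if_same.
  rewrite (nth_map None) //; case e: (nth None p (i - s)) => [b|] //=.
  by rewrite -(mt _ _ ip e) -addrA -PoszD subnKC.
rewrite ez trim_pad // eqxx andbT em /support_at find_support_at // eqxx.
by rewrite has_support_at.
Qed.

Definition occurrences (p : pattern) (X : config) (a : int) (n : nat) : nat :=
  (\sum_(s < n) ((s + size p <= n) && matches p X (a + s%:Z)))%N.

Lemma card_masks (X : config) (a : int) (n : nat) (p : pattern) : is_pattern p ->
  (\sum_(m : n.-tuple bool | has id m) (pat_of (segment X a n) m == p) =
  occurrences p X a n)%N.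
Proof.
move=> pp; rewrite /occurrences big_mkcond.
transitivity (\sum_(m : n.-tuple bool) \sum_(s < n)
   ((find id m == s) && (has id m && (pat_of (segment X a n) m == p))))%N.
  apply: eq_bigr => m _; case: (boolP (has id m)) => hm /=; last first.
    by rewrite big1 // => s _; rewrite andbF.
  have fm : (find id m < n)%N by rewrite -[X in (_ < X)%N](size_tuple m) -has_find.
  rewrite (bigD1 (Ordinal fm)) //= eqxx big1 ?addn0 // => s /negP sn.
  case: eqP => // e; case: sn; apply/eqP/val_inj; by rewrite /= e.
rewrite exchange_big; apply: eq_bigr => s _.
transitivity (\sum_(m : n.-tuple bool) ((m == support_at p n s :> seq bool) &&
    ((s + size p <= n) && matches p X (a + (s : nat)%:Z))))%N.
  by apply: eq_bigr => m _; rewrite mask_patternE ?size_tuple.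
case: (boolP (_ && _)) => [/andP[sn mt]|_]; last first.
  by rewrite big1 // => m _; rewrite andbF.
have ss : size (support_at p n s) == n.
  by rewrite /support_at !size_cat !size_nseq size_map; apply/eqP; lia.
rewrite (bigD1 (Tuple ss)) //= eqxx big1 // => m mn.
by rewrite andbT; case: eqP => // e; case/negP: mn; apply/eqP/val_inj.
Qed.

Lemma is_pattern_pat_of (X : config) (a : int) (n : nat) (m : seq bool) :
  size m = n -> has id m -> is_pattern (pat_of (segment X a n) m).
Proof.
move=> sm hm; have smw : size m = size (segment X a n) by rewrite size_segment.
have [] // := @trim_decomp (cells (segment X a n) m).
by rewrite -[isSome]/(id \o isSome) -has_map isSome_cells.
Qed.

(** [Hw] on an arbitrary segment, indexed by [n]-tuples so that the index type is not tied to the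
    size of a computed list. *)
Definition Hseg {R : realType} (Phi : energy R) (X : config) (a : int) (n : nat) : R :=
  \sum_(m : n.-tuple bool | has id m) Phi (pat_of (segment X a n) m).

Lemma Hw_window {R : realType} (Phi : energy R) (X : config) (k : nat) :
  Hw Phi (window X k) = Hseg Phi X (- k%:Z) (2 * k + 1).
Proof. by rewrite windowE /Hw size_segment. Qed.

Lemma Hseg_supported {R : realType} (Phi : energy R) (Q : seq pattern) X a n :
  uniq Q -> all is_pattern Q ->
  (forall p, is_pattern p -> p \notin Q -> Phi p = 0) ->
  Hseg Phi X a n = \sum_(p <- Q) Phi p * (occurrences p X a n)%:R.
Proof.
move=> uQ /allP aQ zQ.
transitivity (\sum_(p <- Q) \sum_(m : n.-tuple bool | has id m)
    Phi p * (pat_of (segment X a n) m == p)%:R); last first.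
  rewrite big_seq [RHS]big_seq; apply: eq_bigr => p pQ.
  by rewrite -mulr_sumr -card_masks ?aQ // natr_sum.
rewrite exchange_big; apply: eq_bigr => m hm.
set p0 := pat_of _ _.
have pp0 : is_pattern p0 by apply: is_pattern_pat_of; rewrite ?size_tuple.
case: (boolP (p0 \in Q)) => p0Q.
  rewrite (bigD1_seq p0) //= eqxx mulr1 big1 ?addr0 // => p pn.
  by rewrite eq_sym (negbTE pn) mulr0.
rewrite zQ // big_seq big1 // => p pQ.
by case: eqP => [e|_]; rewrite ?mulr0 //; rewrite -e (negbTE p0Q) in pQ.
Qed.

(** Discarding the nonnegative contributions of patterns outside [Q] leaves an energy supported on
    [Q]. *)
Lemma Hseg_ge {R : realType} (Phi : energy R) (Q : seq pattern) X a n :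
  (forall p, 0 <= Phi p) -> uniq Q -> all is_pattern Q ->
  \sum_(p <- Q) Phi p * (occurrences p X a n)%:R <= Hseg Phi X a n.
Proof.
move=> P0 uQ aQ; pose Psi p := if p \in Q then Phi p else 0.
have := @Hseg_supported R Psi Q X a n uQ aQ.
have zQ p : is_pattern p -> p \notin Q -> Psi p = 0 by rewrite /Psi => _ /negbTE ->.
move=> /(_ zQ) e.
have -> : \sum_(p <- Q) Phi p * (occurrences p X a n)%:R =
          \sum_(p <- Q) Psi p * (occurrences p X a n)%:R.
  by rewrite big_seq [RHS]big_seq; apply: eq_bigr => p pQ; rewrite /Psi pQ.
by rewrite -e; apply: ler_sum => m _; rewrite /Psi; case: ifP.
Qed.

(** The energy is linear in [Phi], and [Phi' - Phi] vanishes on canonical patterns outside [Q]. *)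
Lemma Hseg_perturb {R : realType} (Phi Phi' : energy R) (Q : seq pattern) X a n :
  uniq Q -> all is_pattern Q ->
  (forall p, is_pattern p -> p \notin Q -> Phi p = Phi' p) ->
  Hseg Phi' X a n = Hseg Phi X a n +
    \sum_(p <- Q) (Phi' p - Phi p) * (occurrences p X a n)%:R.
Proof.
move=> uQ aQ zQ.
rewrite -(@Hseg_supported R (fun p => Phi' p - Phi p) Q) //.
  by rewrite -big_split; apply: eq_bigr => m _ /=; rewrite addrCA subrr addr0.
by move=> p pp pQ; rewrite zQ // subrr.
Qed.

(** * Bounded discrepancy of Sturmian words *)

Section Rotation.
Context {R : realType} (phi : R).

Lemma frac_ge0 (x : R) : 0 <= frac x.
Proof. by rewrite /frac subr_ge0 floor_le. Qed.

Lemma frac_lt1 (x : R) : frac x < 1.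
Proof. by rewrite /frac ltrBlDl -intrD1 floorD1_gt. Qed.

Lemma frac_unique (x t : R) (z : int) : x = t + z%:~R -> 0 <= t < 1 -> frac x = t.
Proof.
move=> -> /andP[t0 t1]; rewrite /frac.
suff -> : Num.floor (t + z%:~R) = z by rewrite addrK.
by apply: floor_def; rewrite intrD1; apply/andP; split; lra.
Qed.

Lemma fracE (x : R) : x = frac x + (Num.floor x)%:~R.
Proof. by rewrite /frac subrK. Qed.

(* The representative of [x] mod 1 in (0,1] if [b], in [0,1) otherwise. *)
Definition repr (b : bool) (x : R) : R := if b then 1 - frac (- x) else frac x.

Definition repr_range (b : bool) (t : R) : bool :=
  if b then (0 < t) && (t <= 1) else (0 <= t) && (t < 1).

Lemma repr_unique b (x t : R) (z : int) :
  x = t + z%:~R -> repr_range b t -> repr b x = t.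
Proof.
case: b => /= [ex /andP[t0 t1]|]; last exact: frac_unique.
rewrite (@frac_unique (- x) (1 - t) (- z - 1)).
- by rewrite opprB addrC subrK.
- by rewrite ex rmorphB rmorphN /=; ring.
- by apply/andP; split; lra.
Qed.

Lemma reprP b (x : R) : repr_range b (repr b x) /\ exists z : int, x = repr b x + z%:~R.
Proof.
case: b; rewrite /repr_range /repr.
  have h0 := frac_ge0 (- x); have h1 := frac_lt1 (- x).
  split; first by apply/andP; split; lra.
  exists (- Num.floor (- x) - 1); rewrite rmorphB rmorphN /=.
  have := fracE (- x); lra.
split; first by rewrite frac_ge0 frac_lt1.
by exists (Num.floor x); exact: fracE.
Qed.

(* By [arc_def] below, the indicator of an arc of length [frac (j * phi)]
   starting at 0; the expression makes its orbit sums telescope. *)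
Definition arc (b : bool) (x : R) (j : int) : R :=
  repr b (x - j%:~R * phi) - repr b x + frac (j%:~R * phi).

(** Subtracting [s] from the representative leaves the fundamental domain exactly when it lies in
    the arc of length [s] from 0; then 1 is added back. *)
Lemma repr_sub b (x s t : R) (z : int) : t = s + z%:~R -> 0 <= s < 1 ->
  repr b (x - t) - repr b x + s =
  (if b then repr b x <= s else repr b x < s)%:R.
Proof.
move=> -> /andP[s0 s1]; have [hr [w ew]] := reprP b x.
move: (repr b x) hr ew => r hr ew.
have h : repr b (x - (s + z%:~R)) =
    r - s + (if b then r <= s else r < s)%:R.
  apply: (@repr_unique _ _ _ (w - z - (nat_of_bool (if b then r <= s else r < s))%:Z)).
    by rewrite {1}ew !intrD !mulrNz -!pmulrn; ring.
  case: b {ew} hr => /= /andP[r0 r1].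
    by case: (leP r s) => ? /=; apply/andP; split; lra.
  by case: (ltP r s) => ? /=; apply/andP; split; lra.
by rewrite h; ring.
Qed.

Lemma arc_def b x j :
  arc b x j = (if b then repr b x <= frac (j%:~R * phi)
               else repr b x < frac (j%:~R * phi))%:R.
Proof.
by rewrite /arc; apply: (repr_sub b x (fracE _)); rewrite frac_ge0 frac_lt1.
Qed.

Lemma arc_mul b x i j : frac (i%:~R * phi) <= frac (j%:~R * phi) ->
  arc b x i * arc b x j = arc b x i.
Proof.
rewrite !arc_def -natrM mulnb => h; congr (nat_of_bool _)%:R.
case: b; [case: (leP (repr _ _))|case: (ltP (repr _ _))] => //= k.
  exact: (le_trans k).
exact: (lt_le_trans k).
Qed.

Hypotheses (phi_gt0 : 0 < phi) (phi_lt1 : phi < 1).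

Lemma in_P0_arc b x :
  (in_P0 phi b (frac x))%:R = repr b (x - phi) - repr b x + phi.
Proof.
have phi01 : 0 <= phi < 1 by rewrite (ltW phi_gt0) phi_lt1.
rewrite (@repr_sub b x phi phi 0) ?addr0 //.
congr (nat_of_bool _)%:R; rewrite /in_P0.
have f0 := frac_ge0 x; have f1 := frac_lt1 x.
case: b => /=; last by rewrite frac_ge0.
(* At 0 the two conventions differ: the representative in (0,1] is 1, which exceeds [phi], in
   accordance with the exclusion of 0 from the half-open interval. *)
have [f00|fp] := eqVneq (frac x) 0.
  have -> : 1 - frac (- x) = 1.
    rewrite (@frac_unique (- x) 0 (- Num.floor x)) ?subr0 ?lexx ?ltr01 //.
    by rewrite {1}(fracE x) f00 rmorphN /=; ring.
  by rewrite f00 ltxx /=; apply/esym/negbTE; rewrite -ltNge.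
have fp0 : 0 < frac x by rewrite lt_def fp f0.
rewrite fp0 /=; congr (_ <= _).
rewrite (@frac_unique (- x) (1 - frac x) (- Num.floor x - 1)); first by ring.
  by rewrite {1}(fracE x) rmorphB rmorphN /=; ring.
by apply/andP; split; lra.
Qed.

(** The condition places [x] in the arc from [-i phi] to [(1 - i) phi], a difference of two arcs
    based at 0; the constant accounts for wrapping around. *)
Lemma in_P0_arcs b x (i : int) :
  (in_P0 phi b (frac (x + i%:~R * phi)))%:R =
  1 * arc b x (1 - i) + (- 1 * arc b x (- i) +
    (phi - frac ((1 - i)%:~R * phi) + frac ((- i)%:~R * phi))).
Proof.
rewrite in_P0_arc /arc.
have -> : x - (1 - i)%:~R * phi = x + i%:~R * phi - phi by rewrite rmorphB /=; ring.
have -> : x - (- i)%:~R * phi = x + i%:~R * phi by rewrite rmorphN /=; ring.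
by ring.
Qed.

(* Arcs based at 0 are nested, so their linear span is closed under products. *)
Inductive arc_span : (bool -> R -> R) -> Prop :=
| arc_span_const (c : R) : arc_span (fun _ _ => c)
| arc_span_step (c : R) (j : int) f :
    arc_span f -> arc_span (fun b x => c * arc b x j + f b x).

Lemma eq_arc_span f g : (forall b x, f b x = g b x) -> arc_span f -> arc_span g.
Proof. by move=> e; suff -> : f = g by []; apply/funext => b; apply/funext => x. Qed.

Lemma arc_spanD f g : arc_span f -> arc_span g -> arc_span (fun b x => f b x + g b x).
Proof.
elim=> [c|c j f' _ IH] sg.
  elim: sg => [d|d j g' _ IH]; first exact: arc_span_const.
  by apply: eq_arc_span (arc_span_step d j IH) => b x; ring.
by apply: eq_arc_span (arc_span_step c j (IH sg)) => b x; ring.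
Qed.

Lemma arc_spanZ a f : arc_span f -> arc_span (fun b x => a * f b x).
Proof.
elim=> [c|c j f' _ IH]; first exact: arc_span_const.
by apply: eq_arc_span (arc_span_step (a * c) j IH) => b x; ring.
Qed.

(** The product of two nested arcs is the smaller one, so each term of [f] yields a single arc
    again. *)
Lemma arc_spanM_arc j f : arc_span f -> arc_span (fun b x => arc b x j * f b x).
Proof.
elim=> [c|c i f' _ IH].
  apply: eq_arc_span (arc_span_step c j (arc_span_const 0)) => b x; ring.
have [h|h] := leP (frac (i%:~R * phi)) (frac (j%:~R * phi)).
  apply: eq_arc_span (arc_span_step c i IH) => b x.
  by rewrite -{1}(arc_mul b x h); ring.
apply: eq_arc_span (arc_span_step c j IH) => b x.
by rewrite -{1}(arc_mul b x (ltW h)); ring.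
Qed.

Lemma arc_spanM f g : arc_span f -> arc_span g -> arc_span (fun b x => f b x * g b x).
Proof.
elim=> [c|c j f' _ IH] sg; first exact: arc_spanZ.
apply: eq_arc_span (arc_spanD (arc_spanZ c (arc_spanM_arc j sg)) (IH sg)) => b x.
by ring.
Qed.

(** The bound is uniform in the starting point and the endpoint convention, so that it serves all
    Sturmian words at once. *)
Definition bounded_discrepancy (f : bool -> R -> R) :=
  exists mu C : R, forall b x q,
    `|\sum_(n < q) f b (x + (n : nat)%:R * phi) - q%:R * mu| <= C.

(** The sum telescopes to a difference of two representatives, both in [0,1]. *)
Lemma repr_shift_sum b (y : R) q :
  `|\sum_(n < q) (repr b (y + (n : nat)%:R * phi - phi) - repr b (y + (n : nat)%:R * phi))| <= 1.
Proof.
have bd z : 0 <= repr b z <= 1.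
  by have [] := reprP b z; case: b => /= /andP[? ?] _; apply/andP; split; lra.
have -> : \sum_(n < q) (repr b (y + (n : nat)%:R * phi - phi) - repr b (y + (n : nat)%:R * phi))
   = repr b (y - phi) - repr b (y + q%:R * phi - phi).
  elim: q => [|q IH]; first by rewrite big_ord0 mul0r addr0 subrr.
  rewrite big_ord_recr IH /= -[q.+1]addn1 natrD.
  have -> : y + (q%:R + 1) * phi - phi = y + q%:R * phi by ring.
  by ring.
by move: (bd (y - phi)) (bd (y + q%:R * phi - phi)) => /andP[? ?] /andP[? ?];
  rewrite ler_norml; apply/andP; split; lra.
Qed.

(** A shift by [j phi] is composed of |j| shifts by [phi] in one direction, each costing at most
    1. *)
Lemma arc_discrepancy (j : int) : exists C : R, forall b x q,
  `|\sum_(n < q) (repr b (x + (n : nat)%:R * phi - j%:~R * phi) -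
                  repr b (x + (n : nat)%:R * phi))| <= C.
Proof.
have step (i : int) b x q :
  `|\sum_(n < q) (repr b (x + (n : nat)%:R * phi - (i + 1)%:~R * phi) -
                  repr b (x + (n : nat)%:R * phi - i%:~R * phi))| <= 1.
  rewrite (eq_bigr (fun n : 'I_q => repr b ((x - i%:~R * phi) + (n : nat)%:R * phi - phi)
     - repr b ((x - i%:~R * phi) + (n : nat)%:R * phi))); first exact: repr_shift_sum.
  by move=> n _; rewrite rmorphD /=; congr (repr b _ - repr b _); ring.
elim/int_rect: j => [|n [C IH]|n [C IH]].
- exists 0 => b x q; rewrite big1 ?normr0 // => n _.
  by rewrite mul0r subr0 subrr.
- exists (1 + C) => b x q.
  apply: le_trans (lerD (step n b x q) (IH b x q)).
  rewrite -addn1 PoszD; apply: le_trans (ler_normD _ _).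
  by rewrite -big_split /= le_eqVlt; apply/orP; left; apply/eqP;
    congr (`|_|); apply: eq_bigr => i _; ring.
- exists (1 + C) => b x q.
  have := step (- n%:Z - 1) b x q; rewrite subrK => st.
  apply: le_trans (lerD st (IH b x q)).
  rewrite -addn1 PoszD opprD; rewrite -[X in _ <= X + _]normrN.
  apply: le_trans (ler_normD _ _).
  rewrite -sumrN -big_split /= le_eqVlt; apply/orP; left; apply/eqP;
    congr (`|_|); apply: eq_bigr => i _; ring.
Qed.

Lemma arc_span_discrepancy f : arc_span f -> bounded_discrepancy f.
Proof.
elim=> [c|c j g _ [mu [C IH]]].
  exists c, 0 => b x q.
  by rewrite sumr_const card_ord mulr_natl subrr normr0.
have [D hD] := arc_discrepancy j.
exists (c * frac (j%:~R * phi) + mu), (`|c| * D + C) => b x q.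
apply: le_trans (lerD (ler_wpM2l (normr_ge0 c) (hD b x q)) (IH b x q)).
rewrite -normrM; apply: le_trans (ler_normD _ _).
rewrite le_eqVlt; apply/orP; left; apply/eqP; congr (`|_|).
rewrite big_split -mulr_sumr /= /arc [in LHS]big_split /= sumr_const card_ord.
by rewrite -[_ *+ q]mulr_natl; ring.
Qed.

Definition rotation_word (b : bool) (x : R) : config :=
  fun n => ~~ in_P0 phi b (frac (x + n%:~R * phi)).

(** Matching is the product of the conditions on single cells, each an affine combination of
    arcs. *)
Lemma arc_span_matches p : arc_span (fun b x => (matches p (rotation_word b x) 0)%:R).
Proof.
rewrite /matches; elim: (iota 0 (size p)) => [|i s IH] /=; first exact: arc_span_const.
set t := nth None p i.
suff h : arc_span (fun b x =>
    (nat_of_bool (if t is Some c then rotation_word b x (0 + i%:Z) == c else true))%:R).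
  by apply: eq_arc_span (arc_spanM h IH) => b x; rewrite -natrM mulnb.
case: t => [c|]; last exact: arc_span_const.
have h : arc_span (fun b x => (in_P0 phi b (frac (x + i%:~R * phi)))%:R).
  by apply: eq_arc_span (arc_span_step _ _ (arc_span_step _ _ (arc_span_const _))) => b x;
    rewrite in_P0_arcs.
rewrite /rotation_word add0r; case: c.
  apply: eq_arc_span (arc_spanD (arc_spanZ (- 1) h) (arc_span_const 1)) => b x.
  by case: in_P0 => /=; ring.
by apply: eq_arc_span h => b x; case: in_P0.
Qed.

Lemma sturmian_discrepancy p : exists mu C : R, forall S, sturmian phi S ->
  forall (a : int) (q : nat),
    `|\sum_(n < q) (matches p S (a + (n : nat)%:Z))%:R - q%:R * mu| <= C.
Proof.
have [mu [C h]] := arc_span_discrepancy (arc_span_matches p).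
exists mu, C => S [x [b hS]] a q.
rewrite (eq_bigr (fun n : 'I_q =>
  (matches p (rotation_word b ((x + a%:~R * phi) + (n : nat)%:R * phi)) 0)%:R)).
  exact: h.
move=> n _; congr (nat_of_bool _)%:R; rewrite /matches; apply: eq_all => i.
case: (nth None p i) => // c; rewrite hS /rotation_word; congr (~~ in_P0 _ _ (frac _) == _).
by rewrite add0r !intrD -!pmulrn; ring.
Qed.

End Rotation.

(** * Forbidden distances and periodic sums *)

Section ForbiddenDistances.
Context {R : realType} (phi : R).

Lemma not_forbidden (k : nat) :
  ~~ forbidden phi k -> exists z : int, `|k%:R * phi - z%:~R| < 1 - phi.
Proof.
rewrite negb_and -!ltNge; have e := fracE (k%:R * phi).
have f0 := frac_ge0 (k%:R * phi); have f1 := frac_lt1 (k%:R * phi).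
case/orP => h.
  exists (Num.floor (k%:R * phi)); rewrite -/(frac _) ger0_norm //.
exists (Num.floor (k%:R * phi) + 1); rewrite intrD1 ltr_norml.
by apply/andP; split; lra.
Qed.

Lemma int_small (z : int) : `|z%:~R : R| < 1 -> z = 0.
Proof. by rewrite -intr_norm -[1]/(1%:~R) ltr_int; lia. Qed.

(* The complement of the forbidden arc has length below 1/2, so a step of size
   between 1/4 and 1/2 cannot stay in it twice in a row. *)
Lemma forbidden_three (k d : nat) (e : R) (z : int) :
  3 / 4 < phi -> d%:R * phi = e + z%:~R -> 1 / 4 <= `|e| -> `|e| <= 1 / 2 ->
  [|| forbidden phi k, forbidden phi (k + d) | forbidden phi (k + (d + d))].
Proof.
move=> phi34 ed e14 e12; apply/negPn; rewrite !negb_or; apply/negP => /and3P[].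
move=> /not_forbidden[z0 h0] /not_forbidden[z1 h1] /not_forbidden[z2 h2].
rewrite !natrD !mulrDl ed in h1 h2.
move: h0 h1 h2; set y := k%:R * phi; rewrite !ltr_norml.
move=> /andP[a0 b0] /andP[a1 b1] /andP[a2 b2].
move: e12; rewrite ler_norml => /andP[e1 e2].
(* The three displacements from integers are below 1/4 and |e| is at most 1/2, so these integer
   combinations are below 1 in absolute value and vanish. Hence [2 e] is the difference of the last
   and first displacements, and |e| < 1/4. *)
have s1 : z - z1 + z0 = 0.
  by apply: int_small; rewrite !intrD mulrNz ltr_norml; apply/andP; split; lra.
have s2 : z - z2 + z1 = 0.
  by apply: int_small; rewrite !intrD mulrNz ltr_norml; apply/andP; split; lra.
have {}s1 : z%:~R - z1%:~R + z0%:~R = 0 :> R by rewrite -mulrNz -!intrD s1.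
have {}s2 : z%:~R - z2%:~R + z1%:~R = 0 :> R by rewrite -mulrNz -!intrD s2.
move: e14; rewrite ler_normr => /orP[] ?; lra.
Qed.

(** The range is cut into three blocks of length [t]; distances with the same index in successive
    blocks differ by [t q], so each triple contains a forbidden one. *)
Lemma sum_forbidden_ge (r q t : nat) (e : R) (z : int) :
  3 / 4 < phi -> (t * q)%:R * phi = e + z%:~R -> 1 / 4 <= `|e| -> `|e| <= 1 / 2 ->
  (t <= \sum_(k < t + (t + t)) forbidden phi (r + k * q))%N.
Proof.
move=> phi34 ed e14 e12; rewrite !big_split_ord /= -!(@big_split _ _ addn) /=.
rewrite -[X in (X <= _)%N](card_ord t) -sum1_card; apply: leq_sum => k _.
have := forbidden_three (r + k * q) phi34 ed e14 e12.
have -> : (r + k * q + t * q = r + (t + k) * q)%N by lia.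
have -> : (r + k * q + (t * q + t * q) = r + (t + (t + k)) * q)%N by lia.
by do 3 case: forbidden.
Qed.

(** Let [e0] be the signed distance of [q phi] from a nearest integer and [t] the least number with
    [t |e0| >= 1/4]. Bad approximability gives [|e0| > c / q], hence [t <= 1 + q / (4 c)];
    minimality of [t] and [|e0| <= 1/2] keep [t |e0|] at most 1/2. *)
Lemma badly_approximable_step : badly_approximable phi ->
  exists C : R, 0 < C /\ forall q, (0 < q)%N -> exists t : nat,
    [/\ (0 < t)%N, t%:R <= C * q%:R & exists (e : R) (z : int),
      [/\ (t * q)%:R * phi = e + z%:~R, 1 / 4 <= `|e| & `|e| <= 1 / 2]].
Proof.
move=> [c [c0 hc]]; exists (1 + (4 * c)^-1); split.
  by apply: addr_gt0 => //; rewrite invr_gt0 mulr_gt0.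
move=> q q0; have qR : 0 < q%:R :> R by rewrite ltr0n.
have q1 : 1 <= q%:R :> R by rewrite ler1n.
pose p := Num.floor (q%:R * phi + 1 / 2); pose e0 := q%:R * phi - p%:~R.
have e0h : `|e0| <= 1 / 2.
  have := floor_le (q%:R * phi + 1 / 2); have := floorD1_gt (q%:R * phi + 1 / 2).
  rewrite -/p intrD1 ler_norml /e0 => h1 h2; apply/andP; split; lra.
have e0c : c < `|e0| * q%:R.
  have := hc p q q0.
  have -> : phi - p%:~R / q%:R = e0 / q%:R by rewrite /e0; field; lra.
  rewrite normrM normfV (gtr0_norm qR) ltr_pdivrMr ?exprn_gt0 //.
  by rewrite expr2 !mulrA divfK // gt_eqF.
have e0p : 0 < `|e0|.
  by rewrite normr_gt0; apply/eqP => e0E; move: e0c; rewrite e0E normr0 mul0r; lra.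
have ex : exists t : nat, (1 / 4 <= t%:R * `|e0|).
  exists (Num.bound (`|e0|^-1)); have := archi_boundP (ltW (_ : 0 < `|e0|^-1)).
  rewrite invr_gt0 => /(_ e0p) /ltW h.
  have := ler_wpM2r (ltW e0p) h; rewrite mulVf ?gt_eqF //; lra.
case: (ex_minnP ex) => t ht tmin; have t0 : (0 < t)%N.
  by case: t ht {tmin} => // ; rewrite mul0r; lra.
have t1 : (t%:R - 1) * `|e0| < 1 / 4.
  rewrite ltNge; apply/negP => h.
  have := tmin t.-1; rewrite -subn1 natrB // => /(_ h); lia.
exists t; split=> //.
  have tc : (t%:R - 1) * c <= 1 / 4 * q%:R.
    apply: (@le_trans _ _ ((t%:R - 1) * (`|e0| * q%:R))).
      by rewrite ler_wpM2l ?(ltW e0c) // subr_ge0 ler1n.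
    by rewrite mulrA ler_wpM2r ?(ltW t1) // ltW.
  have : t%:R - 1 <= q%:R / (4 * c).
    by rewrite ler_pdivlMr ?mulr_gt0 //; lra.
  rewrite mulrC mulrDl mul1r; lra.
exists (t%:R * e0), (t%:Z * p); split.
- by rewrite /e0 natrM intrM -pmulrn; ring.
- by rewrite normrM ger0_norm.
- rewrite normrM ger0_norm //; have [->|t2] := eqVneq t 1%N; first by lra.
  have t2R : 0 <= t%:R - 2 :> R by rewrite subr_ge0 ler_nat; lia.
  by have := mulr_ge0 t2R (normr_ge0 e0); lra.
Qed.

End ForbiddenDistances.

(** * Sums of periodic functions *)

Section PeriodicSums.
Context {V : zmodType}.

(** Moving the window by one replaces [g c] by [g (c + q)], the same value. *)
Lemma sum_period_shift (g : int -> V) (q : nat) (a : int) :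
  (forall n, g (n + q%:Z) = g n) -> \sum_(i < q) g (a + (i : nat)%:Z) = \sum_(i < q) g (i : nat)%:Z.
Proof.
move=> gq.
have step (c : int) : \sum_(i < q) g (c + 1 + (i : nat)%:Z) = \sum_(i < q) g (c + (i : nat)%:Z).
  apply: (addrI (g c)).
  transitivity (\sum_(i < q.+1) g (c + (i : nat)%:Z)).
    rewrite big_ord_recl /= addr0; congr (_ + _); apply: eq_bigr => i _.
    by congr (g _); rewrite /bump /=; lia.
  by rewrite big_ord_recr /= gq addrC.
elim/int_rect: a => [|n IH|n IH].
- by apply: eq_bigr => i _; rewrite add0r.
- by rewrite -IH -(step n%:Z); apply: eq_bigr => i _; congr (g _); lia.
- by rewrite -IH -(step (- n.+1%:Z)); apply: eq_bigr => i _; congr (g _); lia.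
Qed.

Lemma sum_mul_ord (g : nat -> V) (K q : nat) :
  \sum_(s < K * q) g s = \sum_(k < K) \sum_(r < q) g (k * q + r)%N.
Proof.
elim: K g => [|K IH] g; first by rewrite !big_ord0.
rewrite mulSn big_split_ord big_ord_recl /=; congr (_ + _).
rewrite (IH (fun s => g (q + s)%N)); apply: eq_bigr => k _; apply: eq_bigr => r _.
by rewrite /bump /= mulSn addnA.
Qed.

Lemma sum_periodic (g : int -> V) (q N : nat) (a : int) :
  (forall n, g (n + q%:Z) = g n) ->
  \sum_(s < N) g (a + (s : nat)%:Z) =
  (\sum_(i < q) g (i : nat)%:Z) *+ (N %/ q) +
  \sum_(s < N %% q) g (a + (N %/ q * q)%:Z + (s : nat)%:Z).
Proof.
move=> gq.
transitivity (\sum_(s < N %/ q * q + N %% q) g (a + (s : nat)%:Z)).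
  by rewrite -divn_eq.
rewrite big_split_ord /=; congr (_ + _); last first.
  by apply: eq_bigr => s _; rewrite PoszD addrA.
rewrite (sum_mul_ord (fun s => g (a + s%:Z))).
rewrite (eq_bigr (fun=> \sum_(i < q) g (i : nat)%:Z)) ?sumr_const ?card_ord // => k _.
rewrite -(sum_period_shift (a + (k * q)%N%:Z) gq).
by apply: eq_bigr => r _; rewrite PoszD addrA.
Qed.

End PeriodicSums.

(** * Counting matches and ones *)

Lemma matches_two_ones (X : config) (n : nat) (s : int) : (0 < n)%N ->
  matches (two_ones n) X s = X s && X (s + n%:Z).
Proof.
case: n => // n _; apply/matchesP/andP => [h|[X0 X1] i b].
  split.
    by have := h 0%N true; rewrite addr0; apply.
  have := h n.+1 true; rewrite /= size_rcons size_nseq ltnSn; apply=> //.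
  by rewrite nth_rcons size_nseq ltnn eqxx.
rewrite /= size_rcons size_nseq ltnS; case: i => [_ [<-]|i] /=; first by rewrite addr0.
rewrite ltnS nth_rcons size_nseq nth_nseq => i_n; case: ltngtP i_n => // -> _ [<-].
by rewrite X1.
Qed.

Lemma matches_m_zeros (X : config) (m : nat) (s : int) :
  reflect (forall i : nat, (i < m)%N -> X (s + i%:Z) = false) (matches (m_zeros m) X s).
Proof.
apply: (iffP (matchesP _ _ _)); rewrite /m_zeros size_nseq => h i.
  by move=> im; apply: h => //; rewrite nth_nseq im.
by move=> b im; rewrite nth_nseq im => -[<-]; apply: h.
Qed.

Lemma occurrences_le p X a n :
  (occurrences p X a n <= \sum_(s < n) matches p X (a + (s : nat)%:Z))%N.
Proof. by apply: leq_sum => s _; case: (s + size p <= _)%N. Qed.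

(** Only starts too close to the right end are lost, at most [size p] of them. *)
Lemma le_occurrences p X a n :
  (\sum_(s < n) matches p X (a + (s : nat)%:Z) <= occurrences p X a n + size p)%N.
Proof.
have bad : (\sum_(s < n) ~~ (s + size p <= n) <= size p)%N.
  elim: n => [|n IH]; first by rewrite big_ord0.
  case: (leqP (size p) n.+1) => h; last first.
    apply: leq_trans (ltnW h); rewrite -[X in (_ <= X)%N](card_ord n.+1) -sum1_card.
    by apply: leq_sum => s _; case: (s + size p <= _)%N.
  rewrite big_ord_recl /= add0n h add0n; apply: leq_trans IH; apply: leq_sum => s _.
  by rewrite /bump /= !addSn ltnS.
apply: leq_trans (leq_add (leqnn _) bad); rewrite -(@big_split _ _ addn) /=.
by apply: leq_sum => s _; case: (s + size p <= _)%N; case: matches.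
Qed.

(** Each complete block of [m] letters contains a one; the added 1 covers the last incomplete
    block. *)
Lemma ones_ge (m : nat) (S : config) (j : int) (q : nat) : (0 < m)%N -> no_m_zeros m S ->
  (q < (\sum_(i < q) S (j + (i : nat)%:Z)%R + 1) * m)%N.
Proof.
move=> m0 hS; have [n] := ubnP q; elim: n q j => // n IH q j qn.
case: (ltnP q m) => qm.
  by rewrite mulnDl mul1n; apply: leq_trans qm _; rewrite leq_addl.
have -> : (\sum_(i < q) S (j + (i : nat)%:Z)%R =
           \sum_(i < m + (q - m)) S (j + (i : nat)%:Z)%R)%N by rewrite subnKC.
rewrite big_split_ord /=.
have := IH (q - m)%N (j + m%:Z)%R _.
have -> : (\sum_(i < q - m) S (j + m%:Z + (i : nat)%:Z)%R =
           \sum_(i < q - m) S (j + (m + i)%N%:Z)%R)%N.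
  by apply: eq_bigr => i _; rewrite PoszD addrA.
have : (0 < \sum_(i < m) S (j + (i : nat)%:Z)%R)%N.
  rewrite lt0n; apply/negP => /eqP /eqP; rewrite sum_nat_eq0 => /forallP h.
  apply: hS; exists j => i im; have := h (Ordinal im); rewrite /= eqb0.
  by move/negbTE.
set A := (\sum_(i < m) _)%N; set B := (\sum_(i < q - m) _)%N => A0 h.
have := h (_ : (q - m < n)%N); nia.
Qed.

(** * Energy of periodic configurations *)

Section AlphaEnergy.
Context {R : realType} (phi alpha : R) (m : nat).
Local Notation H := (H_alpha phi alpha m).

Lemma size_two_ones n : (0 < n)%N -> size (two_ones n) = n.+1.
Proof. by case: n => // n _; rewrite /= size_rcons size_nseq. Qed.

Lemma is_pattern_two_ones n : is_pattern (two_ones n).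
Proof. by rewrite /is_pattern /= last_rcons. Qed.

Lemma is_pattern_m_zeros : (0 < m)%N -> is_pattern (m_zeros m).
Proof.
by case: m => // k _; rewrite /is_pattern /=; elim: k.
Qed.

Lemma H_alpha_ge0 p : 0 <= H p.
Proof.
by rewrite /H_alpha; case: ifP => _; [rewrite invr_ge0 powR_ge0 | case: ifP].
Qed.

Lemma H_alpha_two_ones n : (0 < n)%N -> forbidden phi n ->
  H (two_ones n) = (n%:R `^ alpha)^-1.
Proof.
move=> n0 fn; rewrite /H_alpha size_two_ones // ifT //.
by apply/existsP; exists (Ordinal (ltnSn n)); rewrite /= n0 eqxx.
Qed.

Lemma H_alpha_m_zeros : (0 < m)%N -> H (m_zeros m) = 1.
Proof.
move=> m0; rewrite /H_alpha eqxx; case: existsP => // -[n /andP[/andP[_ /eqP e]]].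
have hd : head None (m_zeros m) = Some false by case: m m0.
by move: (congr1 (head None) e); rewrite hd.
Qed.

Lemma H_alpha_neq0 p : H p != 0 ->
  (exists n, [/\ (0 < n)%N, p = two_ones n & forbidden phi n]) \/ p = m_zeros m.
Proof.
rewrite /H_alpha; case: existsP => [[n /andP[/andP[n0 /eqP pn] fn]] _|_].
  by left; exists n.
by case: (p =P _) => [->|_]; [right | rewrite eqxx].
Qed.

(** A set of positions with nonzero energy would be an occurrence of a forbidden pair or of [m]
    zeros. Thus Sturmian words have energy zero. *)
Lemma Hseg_alpha_eq0 X a n :
  no_m_zeros m X -> no_forbidden_ones phi X -> Hseg H X a n = 0.
Proof.
move=> X0 X1; rewrite /Hseg big1 // => v hv; set p := pat_of _ _.
have sv : size v = n by rewrite size_tuple.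
have := mask_patternE X a (find id v) (is_pattern_pat_of X a sv hv) sv.
rewrite !eqxx hv => /esym /and3P[_ _]; rewrite -/p => mp.
apply/eqP/negP => /negP /H_alpha_neq0 [[k [k0 pk fk]]|pk]; rewrite pk in mp.
  move: mp; rewrite matches_two_ones // => /andP[Xs Xk].
  by have := X1 _ _ Xs Xk; rewrite fk.
by apply: X0; exists (a + (find id v)%:Z); exact/matches_m_zeros.
Qed.

Lemma periodic_mul (W : config) (q k : nat) (n : int) :
  (forall n, W (n + q%:Z) = W n) -> W (n + (k * q)%N%:Z) = W n.
Proof.
move=> Wq; elim: k n => [|k IH] n; first by rewrite mul0n addr0.
by rewrite mulSn addnC PoszD addrA Wq IH.
Qed.

(** Fix a one at [i] and a residue [r]: by periodicity all distances [k q + r + 1] lead to the same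
    letter, and at least [t] of them are forbidden. Summing over pairs of ones gives the square. *)
Lemma forbidden_pairs_ge (W : config) (q t : nat) (e : R) (z : int) :
  3 / 4 < phi -> (t * q)%:R * phi = e + z%:~R -> 1 / 4 <= `|e| -> `|e| <= 1 / 2 ->
  (forall n, W (n + q%:Z) = W n) ->
  t%:R * (\sum_(i < q) W (i : nat)%:Z)%:R ^+ 2 <=
  \sum_(n < (t + (t + t)) * q) (forbidden phi n.+1)%:R *
     \sum_(i < q) (W (i : nat)%:Z && W ((i : nat)%:Z + n.+1%:Z))%:R :> R.
Proof.
move=> phi34 ed e14 e12 Wq; set T := (t + (t + t))%N.
have Wq' n : (W (n + q%:Z))%:R = (W n)%:R :> R by rewrite Wq.
under [X in _ <= X]eq_bigr => n _ do rewrite mulr_sumr.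
rewrite exchange_big /= expr2 natr_sum mulr_suml mulr_sumr; apply: ler_sum => i _.
rewrite mulrCA; case: (boolP (W (i : nat)%:Z)) => Wi /=; last first.
  by rewrite mul0r; apply: sumr_ge0 => n _; rewrite mulr0.
rewrite mul1r.
rewrite (sum_mul_ord (fun n => (forbidden phi n.+1)%:R * (W ((i : nat)%:Z + n.+1%:Z))%:R)).
(* One factor of the square is reindexed from position [i + 1], so that its index is the residue
   [r]. *)
rewrite exchange_big /= -(sum_period_shift (i.+1%:Z) Wq') mulr_sumr.
apply: ler_sum => r _.
have W_ (k : 'I_T) : W ((i : nat)%:Z + (k * q + r).+1%:Z) = W (i.+1%:Z + (r : nat)%:Z).
  by rewrite -(periodic_mul k (i.+1%:Z + (r : nat)%:Z) Wq); congr (W _); lia.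
under eq_bigr => k _ do rewrite W_.
rewrite -mulr_suml ler_wpM2r // -natr_sum ler_nat.
apply: leq_trans (sum_forbidden_ge r.+1 phi34 ed e14 e12) _.
by apply: eq_leq; apply: eq_bigr => k _; rewrite addSn addnC.
Qed.

(** A forbidden pair at distance at most [M] costs at least [M^(-alpha)], and every full period
    repeats the pairs. The subtracted term bounds the pairs cut off at the right end, at most
    [M + 2] for each of [M] distances. *)
Lemma Hseg_periodic_ge (W : config) (q M : nat) (a : int) (N : nat) :
  1 < alpha -> (0 < M)%N -> (forall n, W (n + q%:Z) = W n) ->
  (M%:R `^ alpha)^-1 * ((N %/ q)%:R * (\sum_(n < M) (forbidden phi n.+1)%:R *
     \sum_(i < q) (W (i : nat)%:Z && W ((i : nat)%:Z + n.+1%:Z))%:R) - M%:R * M.+2%:R)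
  <= Hseg H W a N.
Proof.
move=> alpha1 M0 Wq.
have ik : injective (fun n => two_ones n.+1).
  by move=> x y /(congr1 size); rewrite !size_two_ones // => -[].
have uQ : uniq [seq two_ones n.+1 | n <- iota 0 M] by rewrite map_inj_uniq ?iota_uniq.
have aQ : all is_pattern [seq two_ones n.+1 | n <- iota 0 M].
  by apply/allP => p /mapP[n _ ->]; exact: is_pattern_two_ones.
apply: le_trans (Hseg_ge W a N H_alpha_ge0 uQ aQ).
rewrite big_map (_ : iota 0 M = index_iota 0 M); last by rewrite /index_iota subn0.
rewrite big_mkord.
have -> : M%:R * M.+2%:R = \sum_(n < M) M.+2%:R :> R by rewrite sumr_const card_ord mulr_natl.
rewrite mulr_sumr -sumrB mulr_sumr; apply: ler_sum => n _.
have Mp : 0 < M%:R `^ alpha by rewrite powR_gt0 // ltr0n.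
set c := \sum_(i < q) _; set O := occurrences _ _ _ _.
have cO : (N %/ q)%:R * c <= O%:R + M.+2%:R :> R.
  have := le_occurrences (two_ones n.+1) W a N; rewrite size_two_ones // -/O => h.
  apply: (@le_trans _ _ (O + n.+2)%:R); last first.
    by rewrite natrD lerD2l ler_nat; case: n {c O h} => /= *; lia.
  apply: le_trans (_ : _ <= (\sum_(s < N) matches (two_ones n.+1) W (a + (s : nat)%:Z))%:R) _.
    pose g x := (W x && W (x + n.+1%:Z))%:R : R.
    have gq x : g (x + q%:Z) = g x.
      by rewrite /g Wq (_ : x + q%:Z + n.+1%:Z = x + n.+1%:Z + q%:Z) ?Wq //; lia.
    have -> : (\sum_(s < N) matches (two_ones n.+1) W (a + (s : nat)%:Z))%:R =
        \sum_(s < N) g (a + (s : nat)%:Z).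
      by rewrite natr_sum; apply: eq_bigr => s _; rewrite matches_two_ones.
    rewrite (sum_periodic _ _ gq) mulr_natl lerDl.
    by apply: sumr_ge0 => s _; rewrite /g.
  by rewrite ler_nat.
case: (boolP (forbidden phi n.+1)) => fn; last first.
  rewrite mul0r mulr0 sub0r; apply: (@le_trans _ _ 0).
    by rewrite mulrN oppr_le0 mulr_ge0 // invr_ge0 ltW.
  by rewrite mulr_ge0 ?H_alpha_ge0.
rewrite mul1r H_alpha_two_ones //.
apply: (@le_trans _ _ ((M%:R `^ alpha)^-1 * O%:R)).
  by rewrite ler_wpM2l ?invr_ge0 ?(ltW Mp) // lerBlDr.
rewrite ler_wpM2r // lef_pV2 ?posrE ?powR_gt0 ?ltr0n //.
apply: ge0_ler_powR; rewrite ?nnegrE ?ler_nat //.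
by apply: ltW; apply: lt_trans alpha1.
Qed.

(** The power is at most [x sqrt(x)], and the root of a quadratic bound is linear in [q]. *)
Lemma powR_three_halves_le (x C q : R) : 1 <= x -> alpha <= 3 / 2 -> 0 <= C -> 0 <= q ->
  x <= C * q ^+ 2 -> x `^ alpha <= x * (Num.sqrt C * q).
Proof.
move=> x1 a32 C0 q0 xC; have x0 : 0 < x by apply: lt_le_trans x1.
apply: (@le_trans _ _ (x `^ (1 + 2^-1))).
  by apply: ler_powR => //; lra.
rewrite powRD; last by rewrite (gt_eqF x0) implybT.
rewrite powRr1 ?(ltW x0) // ler_wpM2l ?(ltW x0) // powR12_sqrt ?(ltW x0) //.
by rewrite -(ger0_norm q0) -sqrtr_sqr -sqrtrM // ler_wsqrtr.
Qed.

(** [E] is independent of [W] and [q], as a single [lam] must serve all periods; [A] may depend on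
    both, since it vanishes in the density. *)
Lemma periodic_energy : 3 / 4 < phi -> badly_approximable phi ->
  1 < alpha -> alpha <= 3 / 2 -> (0 < m)%N ->
  exists E : R, 0 < E /\ forall (W : config) (q : nat), (0 < q)%N ->
    (forall n, W (n + q%:Z) = W n) ->
    (q < (\sum_(i < q) W (i : nat)%:Z + 1) * m)%N ->
    exists A : R, forall a N, E * (N %/ q)%:R - A <= Hseg H W a N.
Proof.
move=> phi34 bad alpha1 alpha32 m0.
have [C [C0 hC]] := badly_approximable_step bad.
(* With [o] ones per period, [M^alpha <= 3 t q^2 sqrt(3 C)] and [q <= 2 o m] (for [o >= 1]) give
   [M^alpha <= K t o^2]. *)
pose K := 12 * m%:R ^+ 2 * Num.sqrt (3 * C).
have K0 : 0 <= K by rewrite mulr_ge0 ?sqrtr_ge0 // mulr_ge0 ?exprn_ge0.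
have K1 : 0 < 1 + K by rewrite ltr_pwDl.
(* Adding 1 makes the denominator positive and [E <= 1], which the case without ones uses. *)
exists (1 + K)^-1; split; first by rewrite invr_gt0.
move=> W q q0 Wq qo; set o := (\sum_(i < q) W _)%N in qo.
(* Without ones [W] is constantly 0, and runs of [m] zeros alone give energy at least [N - m]. *)
have [ones0|ones0] := eqVneq o 0%N.
  have W0 n : W n = false.
    have gq x : (W (x + q%:Z))%:R = (W x)%:R :> R by rewrite Wq.
    have := sum_period_shift n gq; rewrite -!natr_sum -/o ones0.
    case: q q0 {Wq qo o ones0 gq} => // q _; rewrite big_ord_recl /= addr0.
    by case: (W n) => //= /eqP; rewrite pnatr_eq0.
  exists m%:R => a N.
  have aQ : all is_pattern [:: m_zeros m] by rewrite /= is_pattern_m_zeros.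
  have := @Hseg_ge R H [:: m_zeros m] W a N H_alpha_ge0 isT aQ.
  rewrite big_seq1 H_alpha_m_zeros // mul1r; apply: le_trans.
  have := le_occurrences (m_zeros m) W a N.
  rewrite (eq_bigr (fun=> 1%N)); last first.
    by move=> s _; rewrite (introT (matches_m_zeros _ _ _)).
  rewrite sum1_card card_ord /m_zeros size_nseq -/(m_zeros m) => h.
  rewrite lerBlDr -natrD; apply: (@le_trans _ _ N%:R); last by rewrite ler_nat.
  apply: (@le_trans _ _ (N %/ q)%:R); last by rewrite ler_nat leq_div.
  by rewrite ler_piMl // invf_le1 // lerDl.
have [t [t0 tC [e [z [ed e14 e12]]]]] := hC q q0.
pose M := ((t + (t + t)) * q)%N.
have M0 : (0 < M)%N by rewrite muln_gt0 q0 !addn_gt0 t0.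
exists ((M%:R `^ alpha)^-1 * (M%:R * M.+2%:R)) => a N.
have := Hseg_periodic_ge a N alpha1 M0 Wq; apply: le_trans.
rewrite mulrBr lerD2r mulrCA mulrC ler_wpM2l //.
apply: le_trans (ler_wpM2l _ (forbidden_pairs_ge phi34 ed e14 e12 Wq)); last first.
  by rewrite invr_ge0 powR_ge0.
rewrite -/o; have Mp : 0 < M%:R `^ alpha by rewrite powR_gt0 // ltr0n.
rewrite ler_pdivlMl // mulrC ler_pdivrMl //.
have tR : 0 < t%:R :> R by rewrite ltr0n.
have ME : M%:R = 3 * t%:R * q%:R :> R by rewrite natrM !natrD; ring.
have pw : M%:R `^ alpha <= M%:R * (Num.sqrt (3 * C) * q%:R).
  apply: powR_three_halves_le => //; first by rewrite ler1n.
    by rewrite mulr_ge0 // ltW.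
  rewrite ME expr2 !mulrA ler_wpM2r // -!mulrA ler_wpM2l //.
apply: le_trans pw _.
have qo2 : q%:R <= 2 * o%:R * m%:R :> R.
  by rewrite -!natrM ler_nat; nia.
have qq : q%:R ^+ 2 <= (2 * o%:R * m%:R) ^+ 2 :> R by rewrite ler_sqr ?nnegrE ?mulr_ge0.
apply: (@le_trans _ _ (K * (t%:R * o%:R ^+ 2))).
  rewrite ME /K.
  have := ler_wpM2l (_ : 0 <= 3 * t%:R * Num.sqrt (3 * C)) qq.
  rewrite mulr_ge0 ?sqrtr_ge0 ?mulr_ge0 // => /(_ isT).
  by rewrite !expr2; lra.
by rewrite ler_wpM2r ?lerDr // mulr_ge0 ?exprn_ge0.
Qed.

End AlphaEnergy.

(** * Comparison of densities *)

Section Comparison.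
Context {R : realType} (phi : R).

Definition repeats_sturmian (W : config) (q : nat) : Prop :=
  [/\ (0 < q)%N, forall n, W (n + q%:Z) = W n &
   exists (t : int) (S : config) (j : int), sturmian phi S /\
     forall i : nat, (i < q)%N -> W (t + i%:Z) = S (j + i%:Z)].

Lemma eq_occurrences p (W S : config) (t j : int) (q : nat) :
  (forall i : nat, (i < q)%N -> W (t + i%:Z) = S (j + i%:Z)) ->
  occurrences p W t q = occurrences p S j q.
Proof.
move=> e; apply: eq_bigr => s _; case: (leqP (s + size p) q) => //= h.
congr nat_of_bool; apply: eq_in_all => i; rewrite mem_iota add0n => ip.
by case: (nth None p i) => // b; rewrite -!addrA -!PoszD e //; lia.
Qed.

Lemma occurrences_dist p X a n :
  `|(occurrences p X a n)%:R - (\sum_(s < n) matches p X (a + (s : nat)%:Z))%:R|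
    <= (size p)%:R :> R.
Proof.
have := occurrences_le p X a n; have := le_occurrences p X a n.
rewrite -!(ler_nat R) natrD => h1 h2; rewrite ler_norml.
by have : 0 <= (size p)%:R :> R by []; move=> h3; apply/andP; split; lra.
Qed.

(** [D] does not depend on [X], [W] or [q]. The count per period differs from that inside the
    Sturmian block only by matches crossing its end, and the counts in the block and in [X] have the
    same mean [mu] up to bounded errors. *)
Lemma occurrences_diff p : 0 < phi -> phi < 1 ->
  exists D : R, forall X W q, sturmian phi X -> repeats_sturmian W q ->
  exists A : R, forall a N,
    `|(occurrences p W a N)%:R - (occurrences p X a N)%:R| <= D * (N %/ q)%:R + A.
Proof.
move=> phi0 phi1; have [mu [C hC]] := sturmian_discrepancy phi0 phi1 p.
exists (C + (size p)%:R + (size p)%:R) => X W q sX [q0 Wq [t [S [j [sS WS]]]]].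
(* The first term bounds the incomplete last period, the others the discrepancy of [X] and the
   matches leaving either segment. *)
exists (q%:R * (1 + `|mu|) + C + (size p)%:R + (size p)%:R) => a N.
pose cnt (Y : config) (b : int) (n : nat) : R := (\sum_(s < n) matches p Y (b + (s : nat)%:Z))%:R.
have hC' Y b n : sturmian phi Y -> `|cnt Y b n - n%:R * mu| <= C.
  by move=> sY; rewrite /cnt natr_sum; exact: hC.
pose g n := (matches p W n)%:R : R.
have gq n : g (n + q%:Z) = g n.
  rewrite /g /matches; congr (nat_of_bool _)%:R; apply: eq_all => i.
  by rewrite addrAC Wq.
pose G := \sum_(i < q) g (i : nat)%:Z.
have GW : G = cnt W t q by rewrite /G -(sum_period_shift t gq) /cnt natr_sum.
have hG : `|G - q%:R * mu| <= C + (size p)%:R + (size p)%:R.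
  have h1 := occurrences_dist p W t q; have h2 := occurrences_dist p S j q.
  rewrite (eq_occurrences p WS) -/(cnt W t q) -GW in h1.
  rewrite -/(cnt S j q) in h2; have h3 := hC' S j q sS.
  move: h1 h2 h3; rewrite !ler_norml => /andP[? ?] /andP[? ?] /andP[? ?].
  by apply/andP; split; lra.
have hW : `|cnt W a N - N%:R * mu| <=
    (C + (size p)%:R + (size p)%:R) * (N %/ q)%:R + q%:R * (1 + `|mu|).
  have -> : cnt W a N = \sum_(s < N) g (a + (s : nat)%:Z) by rewrite /cnt natr_sum.
  rewrite (sum_periodic _ _ gq) -/G.
  have NE : N%:R = (N %/ q)%:R * q%:R + (N %% q)%:R :> R by rewrite -natrM -natrD -divn_eq.
  rewrite NE; set B := (N %/ q)%:R; set r := \sum_(s < N %% q) _.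
  have -> : G *+ (N %/ q) + r - (B * q%:R + (N %% q)%:R) * mu =
     B * (G - q%:R * mu) + (r - (N %% q)%:R * mu) by rewrite -mulr_natl -/B; ring.
  apply: le_trans (ler_normD _ _) _; apply: lerD.
    by rewrite normrM ger0_norm // mulrC ler_wpM2r.
  have rq : (N %% q)%:R <= q%:R :> R by rewrite ler_nat ltnW // ltn_pmod.
  apply: le_trans (ler_normB _ _) _; rewrite mulrDr mulr1; apply: lerD.
    rewrite ger0_norm; last by apply: sumr_ge0.
    apply: le_trans rq; rewrite -[X in _ <= X%:R](card_ord (N %% q)) -sum1_card natr_sum.
    by apply: ler_sum => s _; rewrite /g; case: matches.
  by rewrite normrM ger0_norm // ler_wpM2r.
have hX := hC' X a N sX.
have h1 := occurrences_dist p W a N; have h2 := occurrences_dist p X a N.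
rewrite -/(cnt W a N) in h1; rewrite -/(cnt X a N) in h2.
move: h1 h2 hX hW; rewrite !ler_norml => /andP[? ?] /andP[? ?] /andP[? ?] /andP[? ?].
by apply/andP; split; lra.
Qed.

Lemma occurrences_diff_seq (Q : seq pattern) : 0 < phi -> phi < 1 ->
  exists D : R, forall X W q, sturmian phi X -> repeats_sturmian W q ->
  exists A : R, forall a N,
    \sum_(p <- Q) `|(occurrences p W a N)%:R - (occurrences p X a N)%:R|
      <= D * (N %/ q)%:R + A.
Proof.
move=> phi0 phi1; elim: Q => [|p Q [D IH]].
  by exists 0 => X W q _ _; exists 0 => a N; rewrite big_nil mul0r addr0.
have [D' h'] := occurrences_diff p phi0 phi1.
exists (D' + D) => X W q sX sW.
have [A hA] := IH X W q sX sW; have [A' hA'] := h' X W q sX sW.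
exists (A' + A) => a N; rewrite big_cons mulrDl addrACA.
exact: lerD (hA' a N) (hA a N).
Qed.

End Comparison.

(** * Comparison of lower limits *)

Section LowerLimit.
Context {R : realType}.

Lemma limn_einf_le (u v : (\bar R)^nat) :
  (\forall n \near \oo%classic, (u n <= v n)%E) -> (limn_einf u <= limn_einf v)%E.
Proof.
move=> [n0 _ h]; rewrite !limn_einf_lim; apply: lee_lim.
- exact: is_cvg_einfs.
- exact: is_cvg_einfs.
exists n0 => // n /= n0n; apply: le_ereal_inf_tmp => _ [k /= nk <-].
apply: le_trans (h k _); last exact: leq_trans nk.
by apply: ereal_inf_lbound; exists k.
Qed.

(** For every [e > 0], [K] is at most [e (2 k + 1)] for large [k], so it does not affect the lower
    limit. *)
Lemma density_le (Phi : energy R) (X W : config) (K : R) :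
  (forall k, Hw Phi (window X k) <= Hw Phi (window W k) + K) ->
  (density Phi X <= density Phi W)%E.
Proof.
move=> h; apply/lee_addgt0Pr => e e0; rewrite addeC -limn_einf_shift //.
apply: limn_einf_le; exists (Num.bound (`|K| / e)) => // k /= kK.
rewrite -EFinD lee_fin.
have kp : 0 < (2 * k + 1)%:R :> R by rewrite ltr0n addn1.
rewrite ler_pdivrMr // mulrDl divfK ?gt_eqF // addrC; apply: le_trans (h k) _.
rewrite lerD2l; apply: le_trans (ler_norm K) _.
have := archi_boundP (_ : 0 <= `|K| / e); rewrite divr_ge0 ?(ltW e0) // => /(_ isT).
rewrite ltr_pdivrMr // => /ltW hK; apply: le_trans hK _.
by rewrite mulrC ler_wpM2l ?(ltW e0) // ler_nat; lia.
Qed.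

End LowerLimit.

(** * Stability under perturbations *)

Theorem theorem4p5 (R : realType) (phi alpha : R) (m : nat) :
  3 / 4 < phi -> phi < 1 -> badly_approximable phi ->
  1 < alpha -> alpha <= 3 / 2 ->
  good_m phi m ->
  forall X : config, sturmian phi X ->
  forall P : seq pattern, exists lam : R, 0 < lam /\
    forall Phi' : energy R, perturbation (H_alpha phi alpha m) Phi' lam P ->
    forall W : config, PS phi W ->
      (density Phi' X <= density Phi' W)%E.
Proof.
move=> phi34 phi1 bad alpha1 alpha32 good X sX P.
have phi0 : 0 < phi by lra.
have [X0 X1] := (good X).2 sX.
have m0 : (0 < m)%N.
  by rewrite lt0n; apply/eqP => mE; apply: X0; exists 0; rewrite mE.
(* [P] may contain repetitions and lists that are not canonical; [Q] keeps what the energy sees. *)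
pose Q := undup [seq p <- P | is_pattern p].
have uQ : uniq Q by exact: undup_uniq.
have QP p : p \in Q -> p \in P by rewrite mem_undup mem_filter => /andP[].
have aQ : all is_pattern Q.
  by apply/allP => p; rewrite mem_undup mem_filter => /andP[].
have [E [E0 hE]] := periodic_energy phi34 bad alpha1 alpha32 m0.
have [D hD] := occurrences_diff_seq Q phi0 phi1.
have D1 : 0 < `|D| + 1 by rewrite ltr_wpDl.
(* This choice gives [lam D <= E]: per period, the perturbation gains at most the energy that [W]
   pays. Adding 1 keeps the denominator positive. *)
exists (E / (`|D| + 1)); split; first by rewrite divr_gt0.
set lam := E / _; move=> Phi' [close eqPhi] W [q [q0 [Wq blockW]]].
have sW : repeats_sturmian phi W q by [].
have [A' hA'] := hD X W q sX sW.
have [A hA] : exists A : R, forall a N,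
    E * (N %/ q)%:R - A <= Hseg (H_alpha phi alpha m) W a N.
  (* A period of [W] has as many ones as its Sturmian block, to which [ones_ge] applies. *)
  apply: hE => //; have [t [S [j [sS WS]]]] := blockW.
  have [S0 _] := (good S).2 sS.
  have := ones_ge j q m0 S0; congr (_ < (_ + _) * _)%N.
  have gq n : (W (n + q%:Z))%:R = (W n)%:R :> R by rewrite Wq.
  apply/eqP; rewrite -(eqr_nat R) !natr_sum -(sum_period_shift t gq); apply/eqP.
  by apply: eq_bigr => i _; rewrite WS.
have lam0 : 0 < lam by rewrite divr_gt0.
(* The constant collects the errors that do not grow with the window, [A] from the energy and
   [lam A'] from the frequencies. *)
apply: (@density_le _ _ _ _ (A + lam * A')) => k; rewrite !Hw_window.
set a := - _; set N := (_ + 1)%N.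
have eqQ p : is_pattern p -> p \notin Q -> H_alpha phi alpha m p = Phi' p.
  move=> pp; rewrite mem_undup mem_filter pp /=; exact: eqPhi.
rewrite !(Hseg_perturb _ _ _ uQ aQ eqQ) (Hseg_alpha_eq0 _ _ _ X0 X1) add0r.
set SX := \sum_(p <- Q) _; set SW := \sum_(p <- Q) _.
have diff : SX - SW <= lam * (D * (N %/ q)%:R + A').
  apply: le_trans (ler_wpM2l (ltW lam0) (hA' a N)).
  rewrite -sumrB mulr_sumr big_seq [X in _ <= X]big_seq; apply: ler_sum => p pQ.
  rewrite -mulrBr distrC; apply: le_trans (ler_norm _) _; rewrite normrM.
  by rewrite ler_wpM2r // distrC ltW // close // QP.
have lamD : lam * D * (N %/ q)%:R <= E * (N %/ q)%:R.
  rewrite ler_wpM2r // /lam mulrAC ler_pdivrMr // ler_wpM2l ?(ltW E0) //.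
  by have := ler_norm D; lra.
by have := hA a N; lra.
Qed.
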